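(* Let $E$ be a reflexive rearrangement-invariant function space on $[0,1]$ with absolutely continuous norm and let $T:E\to E$ be a bounded linear operator. Then $T$ is *-narrow if and only if $T(B(E))$ is a poor subset of $E$, where $B(E)$ denotes the closed unit ball of $E$.
   Context: $\mu$ is Lebesgue measure on $[0,1]$. A Köthe function space $X$ on $([0,1],\mu)$ is a Banach space of (classes of) locally integrable Borel functions such that (1) if $|f|\le|g|$ a.e. and $g\in X$ then $f\in X$ and $\|f\|_X\le\|g\|_X$; (2) $\chi_A\in X$ for every Borel set $A$ of finite measure. $X$ is order-continuous if $f_n\downarrow 0$ a.e. with $f_n\in X$ implies $\|f_n\|_X\downarrow0$ (equivalently here, the norm is absolutely continuous); it has the Fatou property if $0\le f_n\in X$, $\sup_n\|f_n\|_X<\infty$, $f_n\uparrow f$ a.e. imply $f\in X$ and $\|f\|_X=\sup_n\|f_n\|_X$. A rearrangement-invariant (r.i.) space is a Köthe function space $X$ on $([0,1],\mu)$ such that: (1) $X$ is order-continuous or has the Fatou property; (2) for every measure-preserving invertible Borel automorphism $\tau$ of $[0,1]$, $f\in X$ iff $f\circ\tau\in X$, and then $\|f\|_X=\|f\circ\tau\|_X$; (3) $\|\chi_{[0,1]}\|_X=1$. For a reflexive r.i. space $E$ the dual $E^*$ is identified with an r.i. space of functions via the pairing $f(x)=\int_{[0,1]} f x\,d\mu$. An operator $S$ on an r.i. space $X$ is narrow if for each measurable set $A$ and each $\varepsilon>0$ there is $x\in X$ with $x^2=\chi_A$, $\int x\,d\mu=0$ and $\|Sx\|<\varepsilon$.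 An operator $T:E\to E$ is *-narrow if its conjugate $T^*:E^*\to E^*$ is narrow. A subset $M$ of an r.i. space with absolutely continuous norm is poor if for each measurable $A\subseteq[0,1]$ and each $\varepsilon>0$ there is a decomposition $A=A^+\sqcup A^-$ into disjoint measurable subsets such that $\left|\int_{A^+}f\,d\mu-\int_{A^-}f\,d\mu\right|<\varepsilon$ for every $f\in M$. *)

(* Defs.v *)
From HB Require Import structures.
From mathcomp Require Import all_boot all_order all_algebra.
From mathcomp Require Import all_classical all_reals all_analysis.

Set Implicit Arguments.
Unset Strict Implicit.
Unset Printing Implicit Defensive.

Import Order.TTheory GRing.Theory Num.Theory.
Import numFieldNormedType.Exports.

Local Open Scope classical_set_scope.
Local Open Scope ring_scope.

Definition bounded_functional (R : realType) (V : normedModType R) :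
    {pred V -> R^o} :=
  mem [set phi : V -> R^o | linear phi /\ bounded_near phi (nbhs (0 : V))].

Record dual (R : realType) (V : normedModType R) := Dual {
  dual_fun :> V -> R^o;
  _ : dual_fun \in @bounded_functional R V }.

Section DualSpace.
Context (R : realType) (V : normedModType R).

HB.instance Definition _ := [isSub for @dual_fun R V].
HB.instance Definition _ := [Choice of dual V by <:].

Lemma bounded_functionalP (phi : V -> R^o) :
  phi \in @bounded_functional R V <->
  linear phi /\ exists M, forall x, `|phi x| <= M * `|x|.
Proof.
split=> [/set_mem[/= lphi]|[lphi [M phiM]]].
  pose L : {linear V -> R^o} := HB.pack phi (GRing.isLinear.Build _ _ _ _ phi lphi).
  move=> /(linear_boundedP L) b; split=> //.
  by have [M [_ /(_ (M + 1))]] := b; rewrite ltrDl ltr01 => /(_ isT); exists (M + 1).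
apply/mem_set; split=> //.
pose L : {linear V -> R^o} := HB.pack phi (GRing.isLinear.Build _ _ _ _ phi lphi).
apply/(linear_boundedP L); exists M; split; first exact: num_real.
by move=> r /ltW Mr x; rewrite (le_trans (phiM x))// ler_wpM2r.
Qed.

Lemma bounded_functional_submod : submod_closed (@bounded_functional R V).
Proof.
split.
  apply/bounded_functionalP; split; first by move=> a x y /=; rewrite scaler0 addr0.
  by exists 0 => x; rewrite normr0 mul0r.
move=> a f g /bounded_functionalP[lf [M fM]] /bounded_functionalP[lg [N gN]].
apply/bounded_functionalP; split.
  move=> k x y; rewrite !fctE /= lf lg !scalerDr !scalerA (mulrC a k).
  by rewrite addrACA.
exists (`|a| * M + N) => x; rewrite mulrDl (le_trans (ler_normD _ _))// lerD//.
by rewrite normrZ -mulrA ler_wpM2l.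
Qed.

HB.instance Definition _ := GRing.isSubmodClosed.Build R (V -> R^o)
  (@bounded_functional R V) bounded_functional_submod.
HB.instance Definition _ := [SubChoice_isSubLmodule of dual V by <:].

Lemma dual_bounded (phi : dual V) : exists M, forall x, `|phi x| <= M * `|x|.
Proof. by have [_] := (bounded_functionalP phi).1 (valP phi). Qed.

Lemma dual_linear (phi : dual V) : linear phi.
Proof. by have [] := (bounded_functionalP phi).1 (valP phi). Qed.

HB.instance Definition _ (phi : dual V) :=
  GRing.isLinear.Build R V R^o *:%R phi (dual_linear phi).

Definition dual_norm (phi : dual V) : R :=
  sup [set `|phi x| | x in [set x : V | `|x| <= 1]].

Lemma dual_norm_has_sup (phi : dual V) :
  has_sup [set `|phi x| | x in [set x : V | `|x| <= 1]].
Proof.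
split; first by exists `|phi 0|, 0 => //=; rewrite normr0.
have [M phiM] := dual_bounded phi; exists `|M| => _ [x /= x1 <-].
by rewrite (le_trans (phiM x))// (le_trans (ler_norm _))// normrM ler_piMr// normr_id.
Qed.

Lemma ler_dual_norm (phi : dual V) (x : V) : `|phi x| <= dual_norm phi * `|x|.
Proof.
have [->|x0] := eqVneq x 0; first by rewrite linear0 !normr0 mulr0.
have nx0 : 0 < `|x| by rewrite normr_gt0.
rewrite -ler_pdivrMr//.
have -> : `|phi x| / `|x| = `|phi (`|x|^-1 *: x)|.
  by rewrite linearZ /= normrM normfV normr_id mulrC.
apply: (sup_ubound (dual_norm_has_sup phi).2); exists (`|x|^-1 *: x) => //=.
by rewrite normrZ normfV normr_id mulVf// gt_eqF.
Qed.

Lemma dual_norm_le (phi : dual V) (M : R) :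
  (forall x, `|x| <= 1 -> `|phi x| <= M) -> dual_norm phi <= M.
Proof.
move=> phiM; apply: ge_sup; first exact: (dual_norm_has_sup phi).1.
by move=> _ [x /= x1 <-]; exact: phiM.
Qed.

Lemma dual_norm_ge0 (phi : dual V) : 0 <= dual_norm phi.
Proof.
apply: (le_trans (normr_ge0 (phi 0))).
by apply: (sup_ubound (dual_norm_has_sup phi).2); exists 0 => //=; rewrite normr0.
Qed.

Let dual_normD (phi psi : dual V) :
  dual_norm (phi + psi) <= dual_norm phi + dual_norm psi.
Proof.
apply: dual_norm_le => x x1; rewrite (le_trans (ler_normD _ _))// lerD//.
  by rewrite (le_trans (ler_dual_norm _ _))// ler_piMr// dual_norm_ge0.
by rewrite (le_trans (ler_dual_norm _ _))// ler_piMr// dual_norm_ge0.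
Qed.

Let dual_normZ_le (a : R) (phi : dual V) :
  dual_norm (a *: phi) <= `|a| * dual_norm phi.
Proof.
apply: dual_norm_le => x x1; rewrite /= normrM ler_wpM2l//.
by rewrite (le_trans (ler_dual_norm _ _))// ler_piMr// dual_norm_ge0.
Qed.

Let dual_normZ (a : R) (phi : dual V) :
  dual_norm (a *: phi) = `|a| * dual_norm phi.
Proof.
apply/eqP; rewrite eq_le dual_normZ_le /=.
have [->|a0] := eqVneq a 0; first by rewrite normr0 mul0r dual_norm_ge0.
rewrite -ler_pdivlMl ?normr_gt0// -normfV.
by rewrite -{1}[phi]scale1r -(mulVf a0) -scalerA dual_normZ_le.
Qed.

Let dual_norm0_eq0 (phi : dual V) : dual_norm phi = 0 -> phi = 0.
Proof.
move=> phi0; apply/val_inj/funext => x /=; apply/eqP; rewrite -normr_le0.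
by have := ler_dual_norm phi x; rewrite phi0 mul0r.
Qed.

HB.instance Definition _ := Lmodule_isNormed.Build R (dual V)
  dual_normD dual_normZ dual_norm0_eq0.

Lemma dual_normE (phi : dual V) :
  `|phi| = sup [set `|phi x| | x in [set x : V | `|x| <= 1]].
Proof. by []. Qed.

End DualSpace.

Lemma adjoint_subproof (R : realType) (V W : normedModType R)
    (T : {linear V -> W}) (bT : bounded_near T (nbhs (0 : V))) (phi : dual W) :
  (phi \o T : V -> R^o) \in @bounded_functional R V.
Proof.
have [N [_ /(_ (N + 1))]] := (linear_boundedP T).1 bT.
rewrite ltrDl ltr01 => /(_ isT) TN.
have lphi : linear (phi \o T : V -> R^o).
  by move=> a x y /=; rewrite linearP dual_linear.
apply/bounded_functionalP; split=> //; exists (dual_norm phi * (N + 1)) => x /=.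
apply: (le_trans (ler_dual_norm phi (T x))).
by rewrite -mulrA; apply: ler_wpM2l; [exact: dual_norm_ge0|exact: TN].
Qed.

Definition adjoint (R : realType) (V W : normedModType R) (T : {linear V -> W})
    (bT : bounded_near T (nbhs (0 : V))) (phi : dual W) : dual V :=
  Dual (adjoint_subproof bT phi).

(* Surjectivity of the canonical embedding of V into its bidual. *)
Definition reflexive_space (R : realType) (V : normedModType R) : Prop :=
  forall Phi : dual (dual V), exists x : V, forall phi : dual V, Phi phi = phi x.

(* Functions on [0, 1] are functions R -> R considered on [0, 1] only; Borel
   sets are subsets of [0, 1], and mu is Lebesgue measure on Borel sets. *)

Notation I01 := (`[0%R, 1%R]%classic : set (measurableTypeR _)).

(* [koethe_fun x] is a representative of the class x. The embedding of the
   Banach space into the classes of functions is linear and injective. Since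
   [0, 1] has finite measure, local integrability is integrability. *)
Record koetheSpace (R : realType) := KoetheSpace {
  koethe_car :> completeNormedModType R;
  koethe_fun : koethe_car -> R -> R;
  koethe_integrable : forall x,
    (@lebesgue_measure R).-integrable I01 (EFin \o koethe_fun x);
  koethe_linear : forall (a : R) (x y : koethe_car),
    koethe_fun (a *: x + y) = (fun t => a * koethe_fun x t + koethe_fun y t)
      %[ae (@lebesgue_measure R) in I01];
  koethe_inj : forall x y : koethe_car,
    koethe_fun x = koethe_fun y %[ae (@lebesgue_measure R) in I01] -> x = y;
  koethe_ideal : forall (f : R -> R) (y : koethe_car),
    measurable_fun I01 f ->
    (\forall t \ae (@lebesgue_measure R), I01 t -> `|f t| <= `|koethe_fun y t|) ->
    exists2 x : koethe_car,
      koethe_fun x = f %[ae (@lebesgue_measure R) in I01] & `|x| <= `|y|;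
  koethe_indic : forall A : set R, measurable A -> A `<=` I01 ->
    exists x : koethe_car,
      koethe_fun x = \1_A %[ae (@lebesgue_measure R) in I01] }.

Section KoetheSpaces.
Context (R : realType).
Local Notation mu := (@lebesgue_measure R).
Implicit Type X : koetheSpace R.

Definition koethe_class X (x : X) (f : R -> R) : Prop :=
  koethe_fun x = f %[ae mu in I01].

Definition order_continuous X : Prop := forall u : nat -> X,
  (\forall t \ae mu, I01 t ->
     nonincreasing_seq (fun n => koethe_fun (u n) t) /\
     koethe_fun (u n) t @[n --> \oo] --> (0 : R)) ->
  nonincreasing_seq (fun n => `|u n|) /\ `|u n| @[n --> \oo] --> (0 : R).

Definition fatou_property X : Prop := forall (u : nat -> X) (f : R -> R),
  measurable_fun I01 f ->
  (forall n, \forall t \ae mu, I01 t -> 0 <= koethe_fun (u n) t) ->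
  (exists M : R, forall n, `|u n| <= M) ->
  (\forall t \ae mu, I01 t ->
     nondecreasing_seq (fun n => koethe_fun (u n) t) /\
     koethe_fun (u n) t @[n --> \oo] --> f t) ->
  exists2 x : X, koethe_class x f & `|x| = sup (range (fun n => `|u n|)).

Definition abs_continuous_norm X : Prop := forall (x : X) (e : R), 0 < e ->
  exists2 d : R, 0 < d & forall A : set R, measurable A -> A `<=` I01 ->
    (mu A < d%:E)%E ->
    forall y : X, koethe_class y (fun t => koethe_fun x t * \1_A t) -> `|y| < e.

Definition mp_automorphism (tau : R -> R) : Prop :=
  [/\ set_bij I01 I01 tau, measurable_fun I01 tau,
      forall A : set R, measurable A -> A `<=` I01 -> measurable (tau @` A) &
      forall A : set R, measurable A -> A `<=` I01 ->
        mu (I01 `&` tau @^-1` A) = mu A].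

Definition rearrangement_invariant X : Prop :=
  [/\ order_continuous X \/ fatou_property X,
      forall tau : R -> R, mp_automorphism tau ->
        forall f : R -> R, measurable_fun I01 f ->
          ((exists x : X, koethe_class x f) <->
           (exists y : X, koethe_class y (f \o tau))) /\
          (forall x y : X, koethe_class x f -> koethe_class y (f \o tau) ->
             `|x| = `|y|) &
      forall x : X, koethe_class x \1_I01 -> `|x| = 1].

(* E* is identified with a space of functions through phi(x) = \int f x dmu;
   such an f is unique up to a.e. equality on [0, 1]. *)
Definition dual_class X (phi : dual X) (f : R -> R) : Prop :=
  measurable_fun I01 f /\
  forall x : X,
    mu.-integrable I01 (fun t => (f t * koethe_fun x t)%:E) /\
    phi x = \int[mu]_(t in I01) (f t * koethe_fun x t).

(* Narrowness of S on a normed space whose elements are classes of functions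
   on [0, 1]: [cls x f] says that x is the class of f. It is used for a Koethe
   space with [koethe_class], and for its dual with [dual_class]. *)
Definition narrow (V : normedModType R) (cls : V -> (R -> R) -> Prop)
    (S : V -> V) : Prop :=
  forall A : set R, measurable A -> A `<=` I01 -> forall e : R, 0 < e ->
    exists x : V, exists f : R -> R,
      [/\ cls x f, (fun t => f t ^+ 2) = \1_A %[ae mu in I01],
          \int[mu]_(t in I01) f t = 0 & `|S x| < e].

Definition star_narrow X (T : {linear X -> X})
    (bT : bounded_near T (nbhs (0 : X))) : Prop :=
  narrow (@dual_class X) (adjoint bT).

Definition poor X (M : set X) : Prop :=
  forall A : set R, measurable A -> A `<=` I01 -> forall e : R, 0 < e ->
    exists Ap Am : set R,
      [/\ measurable Ap, measurable Am, Ap `|` Am = A, Ap `&` Am = set0 &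
          forall x, M x ->
            `|\int[mu]_(t in Ap) koethe_fun x t -
              \int[mu]_(t in Am) koethe_fun x t| < e].

End KoetheSpaces.

(* Main.v *)
(* A sign x with x^2 = \chi_A defines the functional y |-> \int x y on E, and the
   norm of its image under T^* is the supremum of |\int x (T y)| over the unit
   ball. Narrowness of T^* and poorness of T(B(E)) thus differ only by the
   condition \int x = 0. To obtain it, A is cut into short pieces, signs given by
   poorness on the pieces are added with a greedy choice of orientation, which
   makes \int x small, and x is then reversed on a set of measure |\int x| / 2.
   That set is small, so the change is harmless provided that B(E) is uniformly
   integrable. If it were not, there would be decreasing sets D_m with
   \mu(D_m) --> 0 and nonnegative x_n in B(E) with \int_(D_m) x_n > e for n >= m;
   by reflexivity an ultrafilter limit of the functionals \phi |-> \phi(x_n) is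
   evaluation at some v, and \int_(D_m) v >= e for all m contradicts the
   integrability of v. *)
Require Import Defs.
From mathcomp Require Import all_boot all_order all_algebra.
From mathcomp Require Import all_classical all_reals all_analysis.
From mathcomp Require Import measurable_realfun ring lra.

Set Implicit Arguments.
Unset Strict Implicit.
Unset Printing Implicit Defensive.

Import Order.TTheory GRing.Theory Num.Theory.
Import numFieldNormedType.Exports.
Local Open Scope classical_set_scope.
Local Open Scope ring_scope.

(** * Real-valued integrals under almost everywhere relations *)

Section RintegralComplements.
Context d (T : measurableType d) (R : realType).
Variable mu : {measure set T -> \bar R}.
Implicit Types (D : set T) (f g : T -> R).

Lemma measurable_integrable D f : mu.-integrable D (EFin \o f) ->
  measurable_fun D f.
Proof. by move=> /measurable_int/measurable_EFinP. Qed.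

Lemma ae_eq_Rintegral D f g : measurable D -> measurable_fun D f ->
  measurable_fun D g -> f = g %[ae mu in D] ->
  \int[mu]_(t in D) f t = \int[mu]_(t in D) g t.
Proof.
move=> mD mf mg fg; congr fine; apply: ae_eq_integral => //;
  [exact/measurable_EFinP|exact/measurable_EFinP|].
by apply: filterS fg => t + Dt => ->.
Qed.

(** The minimum of [f] and [g] equals [f] almost everywhere and is at most [g] everywhere, which
    reduces the claim to a pointwise comparison. *)
Lemma ae_le_Rintegral D f g : measurable D ->
  mu.-integrable D (EFin \o f) -> mu.-integrable D (EFin \o g) ->
  (\forall t \ae mu, D t -> f t <= g t) ->
  \int[mu]_(t in D) f t <= \int[mu]_(t in D) g t.
Proof.
move=> mD intf intg fg.
have mf := measurable_integrable intf; have mg := measurable_integrable intg.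
have mfg : measurable_fun D (fun t => Num.min (f t) (g t)).
  exact: measurable_minr.
have fgE : f = (fun t => Num.min (f t) (g t)) %[ae mu in D].
  by apply: filterS fg => t + Dt => /(_ Dt) ftg; rewrite min_l.
rewrite (ae_eq_Rintegral mD mf mfg fgE); apply: le_Rintegral => //.
  have ifg := integrableD mD (integrable_abse intf) (integrable_abse intg).
  apply: le_integrable ifg => //; first exact/measurable_EFinP.
  move=> t Dt; rewrite lee_fin /= [leRHS]ger0_norm ?addr_ge0//; case: (leP (f t) (g t)) => _.
    by rewrite lerDl.
  by rewrite lerDr.
by move=> t Dt; rewrite ge_min lexx orbT.
Qed.

Lemma integrable_bddM D f g : measurable D -> measurable_fun D f ->
  (exists M, forall t, D t -> `|f t| <= M) -> mu.-integrable D (EFin \o g) ->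
  mu.-integrable D (EFin \o (fun t => f t * g t)).
Proof.
move=> mD mf [M fM] intg.
have := integrableZl mD `|M| intg; apply: le_integrable => //.
  by apply/measurable_EFinP; apply: measurable_funM => //; exact: measurable_integrable.
move=> t Dt; rewrite /= lee_fin !normrM normr_id ler_wpM2r//.
by rewrite (le_trans (fM _ Dt))// ler_norm.
Qed.

Lemma Rintegral_indicM D A f : A `<=` D ->
  \int[mu]_(t in A) f t = \int[mu]_(t in D) (\1_A t * f t).
Proof.
move=> AD; rewrite -{1}(setIidr AD) Rintegral_mkcondr; apply: eq_Rintegral.
move=> t _; rewrite patchE indicE.
by case: ifPn => tA; rewrite ?(mul1r, mul0r).
Qed.

End RintegralComplements.

(** * Köthe spaces: order, embedding into L1, functionals given by bounded functions *)

Section Koethe.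
Context (R : realType) (X : koetheSpace R).
Local Notation mu := (@lebesgue_measure R).
Implicit Types (x y z : X) (f g : R -> R).

Lemma measurable_I01 : measurable (I01 : set (measurableTypeR R)).
Proof. exact: measurable_itv. Qed.

Lemma measurable_koethe x : measurable_fun I01 (koethe_fun x).
Proof. exact: measurable_integrable (koethe_integrable x). Qed.

Lemma koethe_fun0 : koethe_fun (0 : X) = (fun=> 0) %[ae mu in I01].
Proof.
(* With [a = 1] and [x = y = 0], linearity says that the representative of 0 is twice itself. *)
have := koethe_linear 1 (0 : X) 0; rewrite scaler0 addr0.
by apply: filterS => t + It => /(_ It); lra.
Qed.

Lemma koethe_funZ a x :
  koethe_fun (a *: x) = (fun t => a * koethe_fun x t) %[ae mu in I01].
Proof.
have := koethe_linear a x 0; rewrite addr0.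
by apply: filterS2 koethe_fun0 => t + + It => /(_ It) -> /(_ It) ->; rewrite addr0.
Qed.

Lemma koethe_funD x y : koethe_fun (x + y) =
  (fun t => koethe_fun x t + koethe_fun y t) %[ae mu in I01].
Proof.
have := koethe_linear 1 x y; rewrite scale1r.
by apply: filterS => t + It => /(_ It) ->; rewrite mul1r.
Qed.

Lemma koethe_funB x y : koethe_fun (x - y) =
  (fun t => koethe_fun x t - koethe_fun y t) %[ae mu in I01].
Proof.
have := koethe_linear (-1) y x; rewrite scaleN1r addrC.
by apply: filterS => t + It => /(_ It) ->; rewrite mulN1r addrC.
Qed.

Lemma koethe_abs x : exists2 y : X,
  koethe_fun y = (fun t => `|koethe_fun x t|) %[ae mu in I01] & `|y| <= `|x|.
Proof.
apply: koethe_ideal; first exact: measurableT_comp (measurable_koethe x).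
by apply: aeW => t _; rewrite normr_id.
Qed.

Definition koethe_nonneg x := \forall t \ae mu, I01 t -> 0 <= koethe_fun x t.

Lemma koethe_nonneg0 : koethe_nonneg 0.
Proof. by apply: filterS koethe_fun0 => t + It => /(_ It) ->. Qed.

Lemma koethe_nonnegD x y : koethe_nonneg x -> koethe_nonneg y ->
  koethe_nonneg (x + y).
Proof.
move=> x0 y0; apply: filterS3 x0 y0 (koethe_funD x y) => t + + + It.
by move=> /(_ It) ? /(_ It) ? /(_ It) ->; rewrite addr_ge0.
Qed.

(* The negative part of a limit x of nonnegative u n is dominated by x - u n. *)
Lemma koethe_nonneg_closed (u : nat -> X) x :
  (forall n, koethe_nonneg (u n)) -> u @ \oo --> x -> koethe_nonneg x.
Proof.
move=> u0 ux; pose g t := Num.max (- koethe_fun x t) 0.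
have mg : measurable_fun I01 g.
  by apply: measurable_maxr => //; apply: measurableT_comp (measurable_koethe x).
have dom n : exists2 z : X, koethe_fun z = g %[ae mu in I01] & `|z| <= `|x - u n|.
  apply: koethe_ideal => //; apply: filterS2 (u0 n) (koethe_funB x (u n)).
  move=> t + + It => /(_ It) unt /(_ It) ->; rewrite /g.
  rewrite ger0_norm ?le_max ?lexx ?orbT// ge_max normr_ge0 andbT.
  by rewrite -normrN (le_trans _ (ler_norm _))// opprB; lra.
(* By injectivity the elements given by [dom] all coincide, so the norm of [z] is at most every
   [|x - u n|], which tends to 0. *)
have [z zg _] := dom 0%N.
have zu n : `|z| <= `|x - u n|.
  have [w wg] := dom n; suff -> : z = w by [].
  by apply: koethe_inj; apply: ae_eq_trans zg (ae_eq_sym wg).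
have z0 : z = 0.
  apply/eqP; rewrite -normr_le0; apply/ler_addgt0Pl => e e0; rewrite addr0.
  have /cvgrPdist_le/(_ _ e0)[N _ /(_ N (leqnn _))] := ux.
  exact: le_trans (zu N).
rewrite z0 in zg; apply: filterS2 zg koethe_fun0 => t zt t0 It.
have := zt It; rewrite (t0 It) => /esym; rewrite /g => /eqP.
by rewrite eq_maxr oppr_le0.
Qed.

Lemma koethe_integral_abs x :
  mu.-integrable I01 (EFin \o (fun t => `|koethe_fun x t|)).
Proof. exact: integrable_abse (koethe_integrable x). Qed.

(** If no constant works, there are nonnegative [y n] of norm at most 2^-n and integral at least n.
    Their series converges to some [s] that dominates every [y n], so [s] cannot have a finite
    integral. *)
Lemma koethe_L1_bounded : exists M : R, forall x,
  \int[mu]_(t in I01) `|koethe_fun x t| <= M * `|x|.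
Proof.
apply: contrapT => nM.
have mI := measurable_I01.
have /choice[y yP] (n : nat) : exists y : X, [/\ koethe_nonneg y,
    `|y| <= 2^-1 ^+ n & n%:R <= \int[mu]_(t in I01) koethe_fun y t].
  (* The factor [2 ^+ n] pays for rescaling [x] to norm 2^-n, which leaves an integral of at least
     n. *)
  have [x xn] : exists x,
      n%:R * 2 ^+ n * `|x| < \int[mu]_(t in I01) `|koethe_fun x t|.
    apply: contrapT => nx; apply: nM; exists (n%:R * 2 ^+ n) => x.
    by rewrite leNgt; apply/negP => xn; apply: nx; exists x.
  have x0 : 0 < `|x|.
    rewrite normr_gt0; apply/eqP => x0; move: xn; rewrite x0 normr0 mulr0.
    suff -> : \int[mu]_(t in I01) `|koethe_fun (0 : X) t| =
        \int[mu]_(t in I01) cst 0 t by rewrite Rintegral_cst// mul0r ltxx.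
    apply: ae_eq_Rintegral => //.
      exact: measurableT_comp (measurable_koethe 0).
    by apply: filterS koethe_fun0 => t + It => /(_ It) ->; rewrite normr0.
  pose a := 2^-1 ^+ n / `|x|.
  have a0 : 0 <= a by rewrite /a divr_ge0// exprn_ge0// invr_ge0.
  have [y ya yx] := koethe_abs (a *: x).
  have yax : koethe_fun y = (fun t => a * `|koethe_fun x t|) %[ae mu in I01].
    apply: filterS2 ya (koethe_funZ a x) => t + + It => /(_ It) -> /(_ It) ->.
    by rewrite normrM ger0_norm.
  exists y; split.
  - by apply: filterS yax => t + It => /(_ It) ->; rewrite mulr_ge0.
  - by rewrite (le_trans yx)// normrZ ger0_norm// /a divfK// gt_eqF.
  - rewrite (ae_eq_Rintegral _ _ _ yax)//; last 2 first.
    + exact: measurable_koethe.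
    + by apply: measurable_funM => //; apply: measurableT_comp (measurable_koethe x).
    rewrite RintegralZl//; last exact: koethe_integral_abs.
    rewrite (le_trans _ (ler_wpM2l a0 (ltW xn)))// /a.
    have -> : 2^-1 ^+ n / `|x| * (n%:R * 2 ^+ n * `|x|) =
        n%:R * (2^-1 ^+ n * 2 ^+ n) * (`|x|^-1 * `|x|) by ring.
    by rewrite -exprMn !mulVf ?gt_eqF// expr1n !mulr1.
have cvg_y : cvgn (series y).
  apply: normed_cvg.
  apply: (@series_le_cvg _ _ (fun n => 2^-1 ^+ n)).
  - by move=> n; exact: normr_ge0.
  - by move=> n; rewrite exprn_ge0// invr_ge0.
  - by move=> n; have [] := yP n.
  - rewrite (_ : (fun n => _) = geometric (1 : R) 2^-1); last first.
      by apply/funext => n; rewrite /= mul1r.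
    by apply: is_cvg_geometric_series; rewrite ger0_norm ?invr_ge0// invf_lt1 ?ltr1n.
set s := lim (series y @ \oo).
have sy n : koethe_nonneg (s - y n).
  (* The shift by [n.+1] puts the term [y n] into every partial sum; removing it leaves a sum of
     nonnegative terms. *)
  apply: (@koethe_nonneg_closed (fun m => series y (n.+1 + m)%N - y n)).
    move=> m; rewrite /series /= big_mkord.
    have nm : (n < n.+1 + m)%N by rewrite ltnS leq_addr.
    rewrite (bigD1 (Ordinal nm))//= addrAC subrr add0r.
    apply: big_ind => [||i _]; [exact: koethe_nonneg0|exact: koethe_nonnegD|].
    by have [] := yP i.
  apply: cvgB; last exact: cvg_cst.
  rewrite (_ : (fun m => _) = [sequence series y (m + n.+1)%N]_m); last first.
    by apply/funext => m; rewrite addnC.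
  by rewrite cvg_shiftn.
have [n] : exists n : nat, \int[mu]_(t in I01) koethe_fun s t < n%:R.
  exists (Num.truncn `|\int[mu]_(t in I01) koethe_fun s t|).+1.
  by rewrite (le_lt_trans (ler_norm _))// truncnS_gt.
apply/negP; rewrite -leNgt; have [_ _ /le_trans] := yP n; apply.
apply: ae_le_Rintegral => //; [exact: koethe_integrable|exact: koethe_integrable|].
apply: filterS2 (sy n) (koethe_funB s (y n)) => t + + It => /(_ It) + /(_ It) E.
by rewrite E subr_ge0.
Qed.

(** Continuity comes from the embedding into L1, as the integral of [f x] is at most that of [|x|]
    in absolute value. Applied to indicators and to signs. *)
Lemma dual_class_exists f : measurable_fun I01 f ->
  (forall t, I01 t -> `|f t| <= 1) -> exists phi : dual X, dual_class phi f.
Proof.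
move=> mf f1; have mI := measurable_I01.
have intf x : mu.-integrable I01 (EFin \o (fun t => f t * koethe_fun x t)).
  by apply: integrable_bddM => //; [exists 1|exact: koethe_integrable].
pose phi x : R^o := \int[mu]_(t in I01) (f t * koethe_fun x t).
have [M XM] := koethe_L1_bounded.
have phiP : phi \in @bounded_functional R X.
  apply/bounded_functionalP; split.
    move=> a x y; rewrite /phi.
    rewrite (@ae_eq_Rintegral _ _ _ mu _ _ (fun t => a * (f t * koethe_fun x t) +
        f t * koethe_fun y t))//.
    - rewrite RintegralD//; first by rewrite RintegralZl.
      by apply: (integrable_bddM (f := cst a)) => //; exists `|a|.
    - by apply: measurable_funM => //; exact: measurable_koethe.
    - apply: measurable_funD; last exact: measurable_integrable (intf y).
      by apply: measurable_funM => //; exact: measurable_integrable (intf x).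
    - apply: filterS (koethe_linear a x y) => t + It => /(_ It) ->; ring.
  exists M => x; apply: le_trans (XM x).
  have phix : `|\int[mu]_(t in I01) (f t * koethe_fun x t)| <=
      \int[mu]_(t in I01) `|f t * koethe_fun x t|.
    exact: (le_normr_Rintegral mI (intf x)).
  apply: (le_trans phix); apply: le_Rintegral => //.
  - exact: integrable_abse (intf x).
  - exact: koethe_integral_abs.
  - by move=> t It; rewrite normrM ler_piMl// f1.
by exists (Dual phiP); split=> // x; split; [exact: intf|].
Qed.

End Koethe.

(** * Limits of bounded families along an ultrafilter *)

Lemma ultra_bounded_cvg (R : realType) (I : Type) (U : set_system I)
    (r : I -> R) (K : R) : UltraFilter U -> (forall i, `|r i| <= K) ->
  cvg (r @ U).
Proof.
move=> UU rK; have UP := @ultra_proper _ _ UU.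
have [|l [_ rl]] := @segment_compact R (- K) K (r @ U) _.
  by apply: (@filterE _ U) => i; rewrite /= in_itv /=; have := rK i; rewrite ler_norml.
apply/cvg_ex; exists l => B Bl.
(* A cluster point of an ultrafilter is a limit: otherwise the preimage of the complement of a
   neighbourhood [B] of [l] would belong to [U], and that complement would meet [B]. *)
have [//|nB] := in_ultra_setVsetC (r @^-1` B) UU.
by have [s []] := rl (~` B) B nB Bl.
Qed.

(** The limit of [phi (x i)] along [U] is linear in [phi] and bounded by [K] times its norm;
    reflexivity turns this element of the bidual into a vector. *)
Lemma reflexive_ultra_cvg (R : realType) (V : normedModType R) (I : Type)
    (U : set_system I) (x : I -> V) (K : R) : reflexive_space V ->
  UltraFilter U -> (forall i, `|x i| <= K) ->
  exists v : V, forall phi : dual V, phi (x i) @[i --> U] --> phi v.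
Proof.
move=> V_refl UU xK; have UP := @ultra_proper _ _ UU.
have bphi (phi : dual V) i : `|phi (x i)| <= `|phi| * K.
  by rewrite (le_trans (ler_dual_norm _ _))// ler_wpM2l// dual_norm_ge0.
have cvgphi (phi : dual V) : cvg ((phi (x i) : R) @[i --> U]).
  by apply: ultra_bounded_cvg (bphi phi).
pose Phi (phi : dual V) : R^o := lim ((phi (x i) : R) @[i --> U]).
have PhiP : Phi \in @bounded_functional R (dual V).
  apply/bounded_functionalP; split.
    move=> a phi psi; apply: cvg_lim => //=.
    by apply: cvgD; [apply: cvgMl_tmp; exact: cvgphi|exact: cvgphi].
  exists K => phi; rewrite mulrC ler_norml; apply/andP; split.
    apply: limr_ge => //; apply: filterE => i.
    by have := bphi phi i; rewrite ler_norml => /andP[].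
  apply: limr_le => //; apply: filterE => i.
  by have := bphi phi i; rewrite ler_norml => /andP[].
have [v vP] := V_refl (Dual PhiP).
by exists v => phi; rewrite -vP; exact: cvgphi.
Qed.

(** * Uniform integrability of the unit ball *)

Section UniformIntegrability.
Context (R : realType).
Local Notation mu := (@lebesgue_measure R).

(** Otherwise mass above [e] sits on sets [C n] of summable measure. The tail unions [D m] then have
    measure tending to 0, while a weak limit [v] keeps mass at least [e] on each of them. *)
Lemma reflexive_uniformly_integrable (X : koetheSpace R) (e : R) :
  reflexive_space X -> 0 < e ->
  exists2 d : R, 0 < d & forall C : set (measurableTypeR R),
    measurable C -> C `<=` I01 -> (mu C < d%:E)%E ->
    forall x : X, `|x| <= 1 ->
      \int[mu]_(t in C) `|koethe_fun x t| <= e.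
Proof.
move=> X_refl e0; apply: contrapT => nd.
have mI := @measurable_I01 R.
have /choice[Cx CxP] (n : nat) : exists Cx : set (measurableTypeR R) * X,
    [/\ measurable Cx.1 /\ Cx.1 `<=` I01,
        (mu Cx.1 < (1 / (2 ^ n.+1)%:R)%:E)%E, `|Cx.2| <= 1,
        koethe_nonneg Cx.2 &
        e < \int[mu]_(t in Cx.1) koethe_fun Cx.2 t].
  apply: contrapT => nCx; apply: nd; exists (1 / (2 ^ n.+1)%:R).
    by rewrite divr_gt0// ltr0n expn_gt0.
  move=> C mC CI muC x x1; rewrite leNgt; apply/negP => ex; apply: nCx.
  (* Replacing [x] by its absolute value makes the integral monotone in the set, so that mass on
     [C n] is kept on [D m]. *)
  have [y yx xy] := koethe_abs x; exists (C, y); split=> //=.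
  - exact: le_trans xy x1.
  - by apply: filterS yx => t + It => /(_ It) ->.
  - rewrite (lt_le_trans ex)// le_eqVlt; apply/orP; left; apply/eqP.
    apply: ae_eq_Rintegral => //.
    + exact: measurable_funS CI (measurable_integrable (koethe_integral_abs x)).
    + exact: measurable_funS CI (measurable_koethe y).
    + by apply: ae_eq_subset CI (ae_eq_sym yx).
pose C n := (Cx n).1; pose x n := (Cx n).2.
pose D m := \bigcup_k C (m + k)%N.
have mC n : measurable (C n) by have [[]] := CxP n.
have mD m : measurable (D m) by apply: bigcup_measurable => k _; exact: mC.
have DI m : D m `<=` I01.
  by move=> t [k _]; have [[_ +] _ _ _ _] := CxP (m + k)%N; apply.
have muD m : (mu (D m) <= (2^-1 ^+ m)%:E)%E.
  apply: (le_trans (measure_sigma_subadditive mu (F := fun k => C (m + k)%N) _ (mD m)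
    (@subset_refl _ _))) => //.
  apply: le_trans (epsilon_trick0 xpredT _); last by rewrite exprn_ge0// invr_ge0.
  apply: lee_nneseries => // k _; have [_ /ltW + _ _ _] := CxP (m + k)%N.
  move=> /le_trans; apply; rewrite lee_fin -addnS expnD natrM invfM mul1r.
  by rewrite exprVn natrX.
(* [U] refines convergence to infinity, so bounds valid for all [n >= m] pass to the limit. *)
have [U [UU ooU]] := ultraFilterLemma eventually_filter.
have UP := @ultra_proper _ _ UU.
have x1 n : `|x n| <= 1 by have [] := CxP n.
have [v vP] := reflexive_ultra_cvg X_refl UU x1.
have intD m (z : X) : mu.-integrable (D m) (EFin \o koethe_fun z).
  exact: integrableS (DI m) (koethe_integrable z).
have vD m : e <= \int[mu]_(t in D m) koethe_fun v t.
  have [||phi [_ phiP]] := @dual_class_exists R X \1_(D m).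
  - exact: measurable_indic.
  - by move=> t _; rewrite indicE; case: (_ \in _); rewrite ?normr1 ?normr0.
  have phiE z : phi z = \int[mu]_(t in D m) koethe_fun z t.
    by rewrite (phiP z).2 -Rintegral_indicM.
  rewrite -phiE; apply: (cvgr_to_ge (vP phi)).
  apply: ooU; exists m => // n /= mn; rewrite phiE.
  have [[_ CI] _ _ xn0 /ltW/le_trans] := CxP n; apply.
  have CD : C n `<=` D m by move=> t Ct; exists (n - m)%N; rewrite ?subnKC.
  rewrite (Rintegral_indicM _ _ CD); apply: ae_le_Rintegral => //.
  - apply: (integrable_bddM (f := \1_(C n)) _ _ _ (intD m (x n))) => //.
      by exists 1 => t _; rewrite indicE; case: (_ \in _); rewrite ?normr1 ?normr0.
  - apply: filterS xn0 => t + Dt => /(_ (DI _ _ Dt)) xt0.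
    by rewrite indicE; case: (_ \in _); rewrite ?mul1r// mul0r.
(* [v] is extended by zero to the line, where absolute continuity of the integral is applied. *)
have intv : mu.-integrable setT (EFin \o (koethe_fun v \_ I01)).
  rewrite -restrict_EFin; exact/(integrable_mkcond _ mI)/koethe_integrable.
have [d [d0 dP]] := integral_normr_continuous intv e0.
have [m md] : exists m, 2^-1 ^+ m < d.
  have /cvgrPdist_lt/(_ _ d0)[m _ /(_ m (leqnn m))] : 2^-1 ^+ m @[m --> \oo] --> (0 : R).
    by apply: cvg_expr; rewrite ger0_norm ?invr_ge0// invf_lt1 ?ltr1n.
  by rewrite /= sub0r normrN normrX ger0_norm ?invr_ge0//; exists m.
have := dP _ (mD m) (le_lt_trans (muD m) _); rewrite lte_fin => /(_ md).
apply/negP; rewrite -leNgt (le_trans (vD m))//.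
rewrite (le_trans (ler_norm _))// (le_trans (le_normr_Rintegral (mD m) (intD m v)))//.
rewrite le_eqVlt; apply/orP; left; apply/eqP; apply: eq_Rintegral => t.
by rewrite inE => /DI It; rewrite patchE mem_set.
Qed.

End UniformIntegrability.

(** * Signs supported on a set, and their balancing *)

Section Signs.
Context (R : realType).
Local Notation mu := (@lebesgue_measure R).
Local Notation mR := (measurableTypeR R).
Implicit Types (A B : set mR) (f g : R -> R).

(** The identity is required at every point of the line, not almost everywhere, so that signs can be
    glued and modified pointwise. *)
Definition sign_on A f :=
  measurable_fun [set: mR] (f : mR -> R) /\ forall t, f t ^+ 2 = \1_A t.

Lemma sign_on_le1 A f t : sign_on A f -> `|f t| <= 1.
Proof.
move=> [_ /(_ t)]; rewrite indicE => ft2.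
have : `|f t| ^+ 2 <= 1 by rewrite real_normK ?num_real// ft2; case: (_ \in _).
by rewrite expr_le1.
Qed.

Lemma sign_on_out A f t : sign_on A f -> ~ A t -> f t = 0.
Proof.
move=> [_ /(_ t)] + At; rewrite indicE memNset// => /eqP.
by rewrite sqrf_eq0 => /eqP.
Qed.

Lemma sign_on_abs A f t : sign_on A f -> `|f t| = \1_A t.
Proof.
move=> [_ /(_ t)] ft2; apply/eqP; rewrite -(@eqrXn2 _ 2)//.
by rewrite real_normK ?num_real// ft2 indicE; case: (_ \in _); rewrite ?expr1n ?expr0n.
Qed.

Lemma sign_onM_integrable A f g : sign_on A f ->
  mu.-integrable I01 (EFin \o g) ->
  mu.-integrable I01 (EFin \o (fun t => f t * g t)).
Proof.
move=> fs ig; apply: integrable_bddM => //; first exact: measurable_funTS fs.1.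
by exists 1 => t _; apply: sign_on_le1 fs.
Qed.

Lemma sign_on_integrable A f : sign_on A f -> mu.-integrable I01 (EFin \o f).
Proof.
move=> fs; have := sign_onM_integrable fs (g := cst 1).
rewrite (_ : (fun t => f t * cst 1 t) = f).
  apply; apply: continuous_compact_integrable; first exact: segment_compact.
  by apply: continuous_subspaceT => t; exact: cvg_cst.
by apply/funext => t; rewrite mulr1.
Qed.

Lemma sign_on_indicB A B : measurable A -> measurable B -> A `&` B = set0 ->
  sign_on (A `|` B) (\1_A \- \1_B).
Proof.
move=> mA mB AB; split; first by apply: measurable_funB; exact: measurable_indic.
move=> t; rewrite /= !indicE in_setU.
have : t \notin A `&` B by rewrite AB in_set0.
rewrite in_setI.
by case: (t \in A); case: (t \in B) => //= _; rewrite ?subr0 ?sub0r ?sqrrN ?subrr ?expr1n ?expr0n.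
Qed.

Lemma sign_onN A f : sign_on A f -> sign_on A (\- f).
Proof.
move=> [mf f2]; split; first exact: measurableT_comp mf.
by move=> t; rewrite /= sqrrN.
Qed.

Lemma sign_onU A B f g : A `&` B = set0 -> sign_on A f -> sign_on B g ->
  sign_on (A `|` B) (f \+ g).
Proof.
move=> AB fs gs; split; first exact: measurable_funD fs.1 gs.1.
move=> t; rewrite /= sqrrD fs.2 gs.2 !indicE in_setU.
have fg0 : f t * g t = 0.
  have [At|/(sign_on_out fs)->] := pselect (A t); last by rewrite mul0r.
  have [Bt|/(sign_on_out gs)->] := pselect (B t); last by rewrite mulr0.
  by have : (A `&` B) t by []; rewrite AB.
rewrite fg0 mul0rn addr0.
have : t \notin A `&` B by rewrite AB in_set0.
by rewrite in_setI; case: (t \in A); case: (t \in B) => //=; rewrite ?addr0 ?add0r.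
Qed.

Lemma sign_on_indic A : measurable A -> sign_on A \1_A.
Proof.
move=> mA; split; first exact: measurable_indic.
by move=> t; rewrite indicE; case: (_ \in _); rewrite ?expr1n ?expr0n.
Qed.

Lemma measure_Rintegral_indic A : measurable A -> A `<=` I01 ->
  mu A = (\int[mu]_(t in I01) \1_A t)%:E.
Proof.
move=> mA AI; have mI := @measurable_I01 R.
rewrite /Rintegral (integral_indic mu mI mA).
rewrite setIidl// fineK// ge0_fin_numE//.
apply: (@le_lt_trans _ _ (mu `[0%R, 1%R]%classic)).
  by apply: le_measure => //; exact/mem_set.
by rewrite lebesgue_measure_itv/= lte_fin ltr01 ltry.
Qed.

(** Since [|f|] is the indicator of [A], the integral is at most the measure of [A]. *)
Lemma sign_on_Rintegral_le A f (a b : R) : A `<=` I01 -> A `<=` `[a, b] ->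
  a <= b -> measurable A -> sign_on A f -> `|\int[mu]_(t in I01) f t| <= b - a.
Proof.
move=> AI Aab ab mA fs.
have := le_normr_Rintegral (@measurable_I01 R) (sign_on_integrable fs).
move=> /le_trans; apply.
rewrite (@eq_Rintegral _ _ _ mu _ \1_A); last by move=> t _; exact: sign_on_abs.
rewrite -lee_fin -measure_Rintegral_indic//.
have mab : measurable (`[a, b]%classic : set mR) by exact: measurable_itv.
have muab : (mu `[a, b]%classic <= (b - a)%:E)%E.
  by rewrite lebesgue_measure_itv/= lte_fin; case: ltP => //; rewrite lee_fin subr_ge0.
by apply: le_trans muab; exact: (le_measure mu (mem_set mA) (mem_set mab) Aab).
Qed.

(* Reversing the sign on half of the excess. *)
Lemma sign_on_rebalance A f : measurable A -> A `<=` I01 -> sign_on A f ->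
  exists h : R -> R, exists B, [/\ sign_on A h, measurable B /\ B `<=` I01,
    (mu B <= `|\int[mu]_(t in I01) f t|%:E)%E,
    \int[mu]_(t in I01) h t = 0 &
    forall t, `|h t - f t| <= 2 * \1_B t].
Proof.
move=> mA AI fs; have mI := @measurable_I01 R.
wlog d0 : f fs / 0 <= \int[mu]_(t in I01) f t.
  move=> H; have [/(H _ fs)//|d0] := leP 0 (\int[mu]_(t in I01) f t).
  have intN : \int[mu]_(t in I01) (\- f) t = - \int[mu]_(t in I01) f t.
    under eq_Rintegral do rewrite /= -mulN1r.
    by rewrite RintegralZl ?mulN1r//; exact: sign_on_integrable fs.
  have [|h [B [hs mB muB hint hf]]] := H _ (sign_onN fs).
    by rewrite intN oppr_ge0 ltW.
  exists (\- h), B; split => //.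
  - exact: sign_onN.
  - by rewrite intN normrN in muB.
  - under eq_Rintegral do rewrite /= -mulN1r.
    by rewrite RintegralZl ?hint ?mulr0//; exact: sign_on_integrable hs.
  - by move=> t; have := hf t; rewrite /= -normrN; congr (_ <= _); congr Num.norm; ring.
set d := \int[mu]_(t in I01) f t in d0 *.
(* Only values 1 get reversed. There is enough room for this: [f] is at most the indicator of [P],
   so [P] has measure at least [d]. *)
pose P : set mR := f @^-1` [set 1].
have mP : measurable P.
  by rewrite -[P]setTI; apply: fs.1 => //; exact: measurable_set1.
have PA : P `<=` A.
  move=> t Pt; apply: contrapT => /(sign_on_out fs) ft0.
  by move: Pt; rewrite /P /= ft0 => /eqP; rewrite eq_sym oner_eq0.
have PI : P `<=` I01 by exact: subset_trans AI.
have iP := sign_on_integrable (sign_on_indic mP).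
have fP t : f t <= \1_P t.
  rewrite indicE; case: (boolP (t \in P)) => [|tP]; first by move=> /set_mem; rewrite /P /= => ->.
  have [At|nAt] := pselect (A t); last by rewrite (sign_on_out fs nAt).
  have : (f t - 1) * (f t + 1) = 0.
    by rewrite -subr_sqr expr1n fs.2 indicE mem_set// subrr.
  move=> /eqP; rewrite mulf_eq0 subr_eq0 addr_eq0 => /orP[/eqP ft1|/eqP->].
    by move: tP; rewrite notin_setE => /(_ ft1).
  exact: lerN10.
(* [F s] is the measure of [P] up to [s]; it is continuous and runs from 0 to at least [d], hence
   takes the value [d / 2]. *)
pose F s := \int[mu]_(t in `[0, s]) \1_P t.
have F0 : F 0 = 0 by rewrite /F set_itv1 Rintegral_set1.
have F1 : d <= F 1 by apply: le_Rintegral => //; exact: sign_on_integrable fs.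
have [s sI Fs] : exists2 s, s \in `[0, 1] & F s = d / 2.
  apply: IVT => //; first exact: (parameterized_integral_continuous _ iP).
  by rewrite F0 (min_l (le_trans d0 F1)) (max_r (le_trans d0 F1)); move: d0 F1; lra.
have sI01 : (`[0, s]%classic : set mR) `<=` I01.
  move=> t; rewrite /= !in_itv /= => /andP[-> ts].
  by move: sI; rewrite in_itv /= => /andP[_]; exact: le_trans.
pose B : set mR := `[0, s] `&` P.
have mB : measurable B by apply: measurableI => //; exact: measurable_itv.
have BI : B `<=` I01 by move=> t [_ /PI].
have Bd : \int[mu]_(t in I01) \1_B t = d / 2.
  rewrite -Fs; apply: etrans (esym (Rintegral_indicM mu \1_P sI01)).
  apply: eq_Rintegral => t _.
  by rewrite indicI.
have iB := sign_on_integrable (sign_on_indic mB).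
(* On [B] the value 1 becomes -1, which lowers the integral by twice the measure of [B], that is by
   [d]. *)
exists (fun t => f t - 2 * \1_B t), B; split.
- split; first by apply: measurable_funB; [exact: fs.1|apply: measurable_funM => //; exact: measurable_indic].
  move=> t; rewrite -(fs.2 t) indicE; case: (boolP (t \in B)); rewrite ?mulr0 ?subr0//.
  by move=> /set_mem[_]; rewrite /P /= => ->; ring.
- by [].
- by rewrite measure_Rintegral_indic// Bd lee_fin ger0_norm//; move: d0; lra.
- rewrite RintegralB//.
  + by rewrite RintegralZl// Bd -/d; lra.
  + exact: sign_on_integrable fs.
  + by apply: integrable_bddM => //; exists `|2|.
- by move=> t; rewrite addrAC subrr add0r normrN normrM ger0_norm// ger0_norm.
Qed.

End Signs.

(** The hypotheses force [a] and [b] to have the same sign, so their difference is no larger than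
    the larger of the two in absolute value. *)
Lemma ler_normB_of_normD (R : realDomainType) (a b c : R) :
  `|a| <= c -> `|b| <= c -> c < `|a + b| -> `|a - b| <= c.
Proof.
rewrite !ler_norml ltr_normr => /andP[? ?] /andP[? ?] /orP[] ?;
  by apply/andP; split; lra.
Qed.

(** * Almost balanced signs obtained from poorness *)

Section Poor.
Context (R : realType) (X : koetheSpace R).
Local Notation mu := (@lebesgue_measure R).
Local Notation mR := (measurableTypeR R).
Implicit Types (A : set mR) (f : R -> R) (M : set X).

Lemma koethe_signM_integrable A f (x : X) : sign_on A f ->
  mu.-integrable I01 (EFin \o (fun t => f t * koethe_fun x t)).
Proof. by move=> fs; apply: sign_onM_integrable fs (koethe_integrable x). Qed.

Lemma poor_sign M A (e : R) : poor M -> measurable A -> A `<=` I01 -> 0 < e ->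
  exists2 f, sign_on A f &
    forall x, M x -> `|\int[mu]_(t in I01) (f t * koethe_fun x t)| < e.
Proof.
move=> poorM mA AI e0.
have [Ap [Am [mAp mAm ApmA Apm0 Apme]]] := poorM A mA AI e e0.
exists (\1_Ap \- \1_Am); first by rewrite -ApmA; exact: sign_on_indicB.
have ApI : Ap `<=` I01 by move=> t ?; apply: AI; rewrite -ApmA; left.
have AmI : Am `<=` I01 by move=> t ?; apply: AI; rewrite -ApmA; right.
move=> x Mx; have := Apme x Mx.
rewrite (Rintegral_indicM mu _ ApI) (Rintegral_indicM mu _ AmI) -RintegralB.
- by under eq_Rintegral do rewrite -mulrBl.
- exact: measurable_I01.
- by apply: koethe_signM_integrable; exact: sign_on_indic mAp.
- by apply: koethe_signM_integrable; exact: sign_on_indic mAm.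
Qed.

(* Signs found on consecutive short pieces of A are added up, each time with
   the orientation that keeps the running integral bounded by one piece. *)
Lemma poor_sign_almost_balanced M A (e : R) (n : nat) :
  poor M -> measurable A -> A `<=` I01 -> 0 < e ->
  exists f, [/\ sign_on A f, `|\int[mu]_(t in I01) f t| <= n.+1%:R^-1 &
    forall x, M x -> `|\int[mu]_(t in I01) (f t * koethe_fun x t)| <= e].
Proof.
move=> poorM mA AI e0; have mI := @measurable_I01 R.
pose N : R := n.+1%:R; have N0 : 0 < N by rewrite ltr0n.
(* There are [n.+2] pieces, and their errors add up. *)
pose d : R := e / n.+2%:R; have d0 : 0 < d by rewrite divr_gt0.
pose P k : set mR := A `&` `]-oo, k%:R / N[.
pose Q k : set mR := A `&` `[k%:R / N, k.+1%:R / N[.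
have mP k : measurable (P k) by apply: measurableI => //; exact: measurable_itv.
have mQ k : measurable (Q k) by apply: measurableI => //; exact: measurable_itv.
have QI k : Q k `<=` I01 by move=> t [/AI].
have PQ0 k : P k `&` Q k = set0.
  apply/seteqP; split=> t //; rewrite /P /Q /= !in_itv /= => -[[_ tk] [_]].
  by rewrite leNgt tk.
have PQ k : P k `|` Q k = P k.+1.
  rewrite -setIUr; congr (_ `&` _); apply/seteqP; split=> t /=; rewrite !in_itv /=.
    move=> [/lt_le_trans|/andP[]//]; apply.
    by rewrite ler_pM2r ?invr_gt0// ler_nat.
  by move=> tk; have [|] := ltP t (k%:R / N); [left|right; rewrite tk andbT].
(* The intervals are open on the right, so the first [n.+1] pieces miss the point 1; one more piece
   covers it. *)
have P_n : P n.+2 = A.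
  apply/setIidl => t /AI /=; rewrite !in_itv /= => /andP[_ t1].
  by rewrite (le_lt_trans t1)// ltr_pdivlMr// mul1r ltr_nat.
have H : forall k, exists f, [/\ sign_on (P k) f,
    `|\int[mu]_(t in I01) f t| <= N^-1 & forall x, M x ->
    `|\int[mu]_(t in I01) (f t * koethe_fun x t)| <= k%:R * d].
  elim=> [|k [f [fs fN fM]]].
    exists (cst 0); split.
    - split; first exact: measurable_cst.
      move=> t; rewrite expr0n /= indicE memNset//= => -[/AI] /=.
      by rewrite !in_itv /= mul0r leNgt => /andP[/negbTE->].
    - by rewrite Rintegral_cst// mul0r normr0 invr_ge0 ltW.
    - move=> x _; under eq_Rintegral do rewrite mul0r.
      by rewrite Rintegral_cst// !mul0r normr0.
  have [g gs gM] := poor_sign poorM (mQ k) (@QI k) d0.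
  have gN : `|\int[mu]_(t in I01) g t| <= N^-1.
    have -> : N^-1 = k.+1%:R / N - k%:R / N by rewrite -mulrBl -natrB// subSnn mul1r.
    apply: sign_on_Rintegral_le gs => //.
      by move=> t [_] /=; rewrite !in_itv /= => /andP[-> /ltW].
    by rewrite ler_pM2r ?invr_gt0// ler_nat.
  (* If adding [g] overshoots, [\- g] is used: it satisfies the same bounds and brings the running
     integral back. *)
  wlog fg : g gs gM gN / `|\int[mu]_(t in I01) f t + \int[mu]_(t in I01) g t| <= N^-1.
    move=> H; have [|h] := leP `|\int[mu]_(t in I01) f t + \int[mu]_(t in I01) g t| N^-1.
      exact: H.
    have gE : \int[mu]_(t in I01) (\- g) t = - \int[mu]_(t in I01) g t.
      under eq_Rintegral do rewrite /= -mulN1r.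
      by rewrite RintegralZl ?mulN1r//; exact: sign_on_integrable gs.
    apply: (H (\- g)); rewrite ?gE ?normrN//; first exact: sign_onN.
      move=> x Mx; under eq_Rintegral do rewrite /= mulNr -mulN1r.
      rewrite RintegralZl ?mulN1r ?normrN//; first exact: gM.
      exact: koethe_signM_integrable gs.
    by rewrite ler_normB_of_normD.
  exists (f \+ g); split.
  - by rewrite -PQ; exact: sign_onU.
  - by rewrite RintegralD//; [exact: sign_on_integrable fs|exact: sign_on_integrable gs].
  - move=> x Mx; under eq_Rintegral do rewrite /= mulrDl.
    rewrite RintegralD//; [|exact: koethe_signM_integrable fs|exact: koethe_signM_integrable gs].
    rewrite (le_trans (ler_normD _ _))// -natr1 mulrDl mul1r lerD//; first exact: fM.
    exact: ltW (gM _ Mx).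
have [f [fs fN fM]] := H n.+2; rewrite P_n in fs.
exists f; split=> // x Mx; rewrite (le_trans (fM x Mx))// /d.
by rewrite mulrC divfK// pnatr_eq0.
Qed.

End Poor.

(** * The two implications *)

Section Corollary.
Context (R : realType) (E : koetheSpace R) (T : {linear E -> E}).
Context (bT : bounded_near T (nbhs (0 : E))).
Local Notation mu := (@lebesgue_measure R).
Local Notation mR := (measurableTypeR R).

(** [A] is split by the sign of the witness [f]. The difference of the two integrals of [T x] is
    then the value at [x] of the adjoint applied to [phi], hence at most its norm on the unit
    ball. *)
Lemma star_narrow_poor : star_narrow bT -> poor (T @` closed_ball (0 : E) 1).
Proof.
move=> Tn A mA AI e e0.
have [phi [f [[mf phif] f2 f0 Tphi]]] := Tn A mA AI e e0.
have mA' : measurable (A : set mR) by [].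
(* Since [f ^+ 2] is 1 only almost everywhere on [A], the pieces are cut out by inequalities, which
   cover [A] exactly; [f] is known to be measurable only on [I01]. *)
pose Ap : set mR := A `&` (I01 `&` f @^-1` `[0, +oo[).
pose Am : set mR := A `&` (I01 `&` f @^-1` `]-oo, 0[).
have mI := @measurable_I01 R.
have mAp : measurable Ap by apply: measurableI => //; apply: mf => //; exact: measurable_itv.
have mAm : measurable Am by apply: measurableI => //; apply: mf => //; exact: measurable_itv.
have Apm0 : Ap `&` Am = set0.
  apply/seteqP; split=> t //= [[_ [_]]] /=; rewrite in_itv /= andbT => f0' [_ [_]] /=.
  by rewrite in_itv /= ltNge f0'.
exists Ap, Am; split => //.
  apply/seteqP; split=> t; first by case=> -[].
  move=> At; have It := AI _ At; have [ft|ft] := ltP (f t) 0; [right|left]; split => //; split=> //=;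
    by rewrite in_itv /= ?ft.
move=> _ [x + <-]; rewrite closed_ballE// /closed_ball_ /= sub0r normrN => x1.
have ApI : Ap `<=` I01 by move=> t [/AI].
have AmI : Am `<=` I01 by move=> t [/AI].
have sgn := sign_on_indicB mAp mAm Apm0.
rewrite (Rintegral_indicM mu _ ApI) (Rintegral_indicM mu _ AmI) -RintegralB//; last 2 first.
  by apply: koethe_signM_integrable; exact: sign_on_indic mAp.
  by apply: koethe_signM_integrable; exact: sign_on_indic mAm.
have -> : \int[mu]_(t in I01) (\1_Ap t * koethe_fun (T x) t - \1_Am t * koethe_fun (T x) t)
    = adjoint bT phi x.
  rewrite /= (phif (T x)).2.
  transitivity (\int[mu]_(t in I01) ((\1_Ap \- \1_Am) t * koethe_fun (T x) t)).
    by apply: eq_Rintegral => t _; rewrite mulrBl.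
  apply: ae_eq_Rintegral => //.
  - exact: measurable_integrable (koethe_signM_integrable (T x) sgn).
  - exact: measurable_integrable (phif (T x)).1.
  (* Wherever [f t ^+ 2] is the indicator of [A], [f t] is 1, -1 or 0 and agrees with the sign of
     the decomposition. *)
  - apply: filterS f2 => t + It => /(_ It) ft2; congr (_ * _); rewrite /=.
    have [At|nAt] := pselect (A t); last first.
      rewrite !indicE !memNset; [|by case|by case].
      rewrite subr0; apply/esym/eqP.
      by rewrite -sqrf_eq0 ft2 indicE memNset.
    have : (f t - 1) * (f t + 1) = 0 by rewrite -subr_sqr expr1n ft2 indicE mem_set// subrr.
    move=> /eqP; rewrite mulf_eq0 subr_eq0 addr_eq0 !indicE => /orP[]/eqP ft.
      rewrite mem_set ?memNset ?ft ?subr0//.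
        by move=> [_ [_]]; rewrite /= ft in_itv /= ltr10.
      by split=> //; split=> //=; rewrite ft in_itv /= ler01.
    rewrite memNset ?mem_set ?ft ?sub0r//.
      by split=> //; split=> //=; rewrite ft in_itv /= ltrN10.
    by move=> [_ [_]]; rewrite /= ft in_itv /= ler0N1.
apply: le_lt_trans Tphi; apply: le_trans (ler_dual_norm _ _) _.
by rewrite ler_piMr// dual_norm_ge0.
Qed.

Lemma poor_star_narrow : reflexive_space E ->
  poor (T @` closed_ball (0 : E) 1) -> star_narrow bT.
Proof.
move=> E_refl Tpoor A mA AI e e0; have mI := @measurable_I01 R.
have [K [_ /(_ (`|K| + 1))]] := (linear_boundedP T).1 bT.
rewrite (le_lt_trans (ler_norm K)) ?ltrDl// => /(_ isT).
set L := `|K| + 1 => TL; have L0 : 0 < L by rewrite ltr_pwDr.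
(* The reversal changes a sign by at most 2, so it costs at most [2 * (L * a)], which is [e / 4];
   poorness costs another [e / 4]. *)
pose a := e / (8 * L); have a0 : 0 < a by rewrite divr_gt0// mulr_gt0.
have [d d0 dP] := reflexive_uniformly_integrable E_refl a0.
(* The reversed set [B] has measure at most [n.+1%:R^-1], hence below the threshold [d]. *)
have [n nd] : exists n : nat, n.+1%:R^-1 < d.
  exists (Num.truncn d^-1); rewrite -[ltRHS]invrK ltf_pV2 ?posrE ?invr_gt0//.
  exact: truncnS_gt.
have e4 : 0 < e / 4 by rewrite divr_gt0.
have [f [fs fn fM]] := poor_sign_almost_balanced n Tpoor mA AI e4.
have [h [B [hs [mB BI] muB h0 hf]]] := sign_on_rebalance mA AI fs.
have [||phi phih] := @dual_class_exists R E h.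
- exact: measurable_funTS hs.1.
- by move=> t _; exact: sign_on_le1 hs.
exists phi, h; split => //; first by apply: aeW => t _; exact: hs.2.
(* The supremum over the ball preserves only a weak inequality; aiming at [e / 2] keeps the final
   one strict. *)
apply: (@le_lt_trans _ _ (e / 2)); last by lra.
apply: dual_norm_le => x x1; rewrite /= (phih.2 (T x)).2.
have Tx1 : (T @` closed_ball (0 : E) 1) (T x).
  by exists x => //; rewrite closed_ballE// /closed_ball_ /= sub0r normrN.
have iT := koethe_integrable (T x).
have hfx : \int[mu]_(t in I01) ((h t - f t) * koethe_fun (T x) t) =
    \int[mu]_(t in I01) (h t * koethe_fun (T x) t) -
    \int[mu]_(t in I01) (f t * koethe_fun (T x) t).
  under eq_Rintegral do rewrite mulrBl.
  by rewrite RintegralB//; [exact: koethe_signM_integrable hs|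
    exact: koethe_signM_integrable fs].
have ihf : mu.-integrable I01 (EFin \o (fun t => (h t - f t) * koethe_fun (T x) t)).
  apply: integrable_bddM => //.
    by apply: measurable_funB; apply: measurable_funTS; [exact: hs.1|exact: fs.1].
  by exists (1 + 1) => t _; rewrite (le_trans (ler_normB _ _))// lerD//;
    [exact: sign_on_le1 hs|exact: sign_on_le1 fs].
have Bx : \int[mu]_(t in B) `|koethe_fun (T x) t| <= L * a.
  (* Uniform integrability concerns the unit ball, so [T x] is scaled into it. *)
  pose y := L^-1 *: T x.
  have y1 : `|y| <= 1.
    rewrite normrZ gtr0_norm ?invr_gt0// ler_pdivrMl// (le_trans (TL _))//.
    by rewrite ler_pM2l.
  have By := dP B mB BI (le_lt_trans muB _) y y1.
  have BTy : (fun t => `|koethe_fun (T x) t|) = (fun t => L * `|koethe_fun y t|)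
      %[ae mu in B].
    apply: (ae_eq_subset BI); apply: filterS (koethe_funZ L^-1 (T x)).
    move=> t + It => /(_ It) ->; rewrite normrM gtr0_norm ?invr_gt0//.
    by rewrite mulrA divff ?mul1r// gt_eqF.
  have iyB := integrableS mI mB BI (koethe_integral_abs y).
  rewrite (ae_eq_Rintegral mB _ _ BTy).
  - by rewrite RintegralZl// ler_pM2l// By// lte_fin (le_lt_trans fn).
  - exact: measurable_funS mI BI (measurable_integrable (koethe_integral_abs (T x))).
  - by apply: measurable_funM => //; exact: measurable_integrable iyB.
have : `|\int[mu]_(t in I01) ((h t - f t) * koethe_fun (T x) t)| <= 2 * (L * a).
  apply: le_trans (le_normr_Rintegral mI ihf) _.
  have iB : mu.-integrable I01 (EFin \o (fun t => \1_B t * `|koethe_fun (T x) t|)).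
    exact: sign_onM_integrable (sign_on_indic mB) (koethe_integral_abs (T x)).
  apply: le_trans (ler_wpM2l _ Bx) => //.
  rewrite (Rintegral_indicM mu _ BI) -RintegralZl//; apply: le_Rintegral => //.
  - exact: integrable_abse ihf.
  - by apply: (integrable_bddM (f := cst 2)) iB => //; exists `|2|.
  - by move=> t _; rewrite normrM mulrA ler_wpM2r.
have -> : 2 * (L * a) = e / 4 by rewrite /a; field; rewrite gt_eqF.
rewrite hfx => h1; have h2 := fM _ Tx1.
have := ler_normD (\int[mu]_(t in I01) (h t * koethe_fun (T x) t) -
  \int[mu]_(t in I01) (f t * koethe_fun (T x) t))
  (\int[mu]_(t in I01) (f t * koethe_fun (T x) t)).
by rewrite subrK => /le_trans; apply; rewrite (le_trans (lerD h1 h2))//; lra.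
Qed.

End Corollary.

Theorem corollary5p6 (R : realType) (E : koetheSpace R)
    (E_ri : rearrangement_invariant E)
    (E_refl : reflexive_space E)
    (E_ac : abs_continuous_norm E)
    (T : {linear E -> E}) (T_bounded : bounded_near T (nbhs (0 : E))) :
  star_narrow T_bounded <-> poor (T @` closed_ball (0 : E) 1).
Proof. by split; [exact: star_narrow_poor|exact: poor_star_narrow]. Qed.
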